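(* Let $P\in\mathcal{P}$ and $q\in Q$. Put $d=|S^+(q),M(q)|$ and let $a,b$ be natural numbers (positive integers) such that $aM(q)-bS^+(q)=d$ and $b\le \frac{M(q)}{d}$. Then: (1) $S^-(q+1)=b\,K(q)$; (2) $S^+(q+1)\equiv b\,K(q)-K(q+1)\pmod{M(q+1)}$.
   Context: Graphs are finite and loopless but may have multiple edges. A plane triangulation is a plane graph all of whose faces (including the outer one) are bounded by cycles of length 3. $\mathcal{P}$ is the family of all 2-connected plane triangulations all of whose vertices have degree 3 or 6. $Q=\{0,1,2\}$ is the cyclic group of integers modulo 3. For $P\in\mathcal{P}$ fix a partition of the edge set into three classes indexed by $Q$ such that for every vertex $v$, if two edges are counterclockwise successive edges incident with $v$, then the first is of class $q$ and the second is of class $q+1$ for some $q\in Q$ (such a partition is known to exist, by Grünbaum and Motzkin). A subgraph is of class $q$ if all of its edges are of class $q$. It is known that the spanning subgraph $P_q$ formed by the edges of class $q$ consists of two induced paths (the maximal paths of class $q$, whose ends are the four vertices of degree 3) of the same length, denoted $M(q)$, and of $K(q)-1$ induced cycles of the same length $2M(q)$, where $K(q)$ is the distance in $P$ between the two maximal paths of class $q$. For a vertex $A$ of degree 3, $[A,q]$ denotes the maximal path of class $q$ having $A$ as an end, oriented as $v_0v_1\ldots v_{M(q)}$ with initial vertex $A=v_0$ and terminal vertex $A_q=v_{M(q)}$. An edge is adjacent to a path if it does not belong to the path but is incident with a vertex of it. An edge $e$ adjacent to $[A,q]$ at the vertex $v_j$ is a left branch of $[A,q]$ if either $0\le j<M(q)$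 and $v_jv_{j+1},e$ are counterclockwise successive edges at $v_j$, or $0<j\le M(q)$ and $e,v_{j-1}v_j$ are counterclockwise successive edges at $v_j$; otherwise it is a right branch. Put $[A,q](e)=j$ if $e$ is a left branch and $[A,q](e)=2M(q)-j$ if $e$ is a right branch. Let $A,C$ be ends of the two different maximal paths of class $q$. Let $f$ (respectively $g$) be the first edge of the oriented path $[C,q+1]$ (respectively $[C,q-1]$) which is adjacent to $[A,q]$. Then $S^+(q)=[A,q](f)$ if $f$ is a left branch of $[A,q]$ and $S^+(q)=[A,q](f)-M(q)$ if $f$ is a right branch; $S^-(q)=[A,q](g)$ if $g$ is a left branch of $[A,q]$ and $S^-(q)=[A,q](g)-M(q)$ if $g$ is a right branch. These values do not depend on the choice of $A$ and $C$, and $0\le S^+(q)<M(q)$, $0<S^-(q)\le M(q)$. $|s,m|$ denotes the greatest common divisor of integers $s\ge 0$ and $m\ge 1$ (so $|0,m|=m$). *)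

(* Defs.v *)
From HB Require Import structures.
From mathcomp Require Import all_boot all_order all_algebra all_fingroup.

Set Implicit Arguments.
Unset Strict Implicit.
Unset Printing Implicit Defensive.

(* A graph drawn on an oriented surface, without isolated vertices, given by
   its rotation system.  A dart is an edge together with one of its two ends,
   its origin; [edge] exchanges the two darts of an edge, and [ccw] sends a
   dart to the counterclockwise next one with the same origin.  Multiple edges
   are allowed. *)
Record gmap := GMap {
  dart :> finType;
  edge : {perm dart};
  ccw : {perm dart};
  edgeK : involutive edge;
  edge_neq : forall x, edge x != x }.

Arguments edge {g}.
Arguments ccw {g}.

Section Maps.

Variable P : gmap.
Implicit Types (x y f : P) (u v w : {set P}) (p r s : seq P).

(* A vertex is identified with the set of darts originating from it. *)
Definition origin x : {set P} := porbit ccw x.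
Definition target x : {set P} := origin (edge x).
Definition vertices : {set {set P}} := porbits (@ccw P).
Definition edges : {set {set P}} := porbits (@edge P).

(* x |-> ccw^-1 (edge x) walks along the boundary of the face to the left
   of x. *)
Definition face : {perm P} := (edge * ccw^-1)%g.
Definition faces : {set {set P}} := porbits face.

Definition adj : rel {set P} :=
  fun u v => [exists x, (u == origin x) && (v == target x)].

Definition loopless : Prop := forall x, origin x != target x.

Definition connected : Prop := {in vertices &, forall u v, connect adj u v}.

Definition two_connected : Prop :=
  [/\ 3 <= #|vertices|, connected &
      forall w, w \in vertices ->
        {in vertices :\ w &, forall u v,
          connect (fun u' v' => [&& adj u' v', u' != w & v' != w]) u v}].

(* A connected map lies on the sphere iff its Euler characteristic is 2. *)
Definition plane : Prop :=
  connected /\ #|vertices| + #|faces| = #|edges| + 2.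

(* In a loopless map, a closed facial walk of length 3 is a cycle. *)
Definition triangulation : Prop := forall x, #|porbit face x| = 3.

Definition degree v : nat := #|v|.

Record family_P : Prop := FamilyP {
  family_loopless : loopless;
  family_plane : plane;
  family_two_connected : two_connected;
  family_triangulation : triangulation;
  family_degree :
    forall v, v \in vertices -> degree v = 3 \/ degree v = 6 }.

(* [c x] is the class of the edge carrying the dart x. *)
Definition class_partition (c : P -> 'Z_3) : Prop :=
  (forall x, c (edge x) = c x) /\ (forall x, c (ccw x) = (c x + 1)%R).

(* A nontrivial oriented path v_0 ... v_m is the sequence of its m darts
   v_0v_1, ..., v_{m-1}v_m. *)
Definition path_vertices p : seq {set P} :=
  if p is x :: _ then origin x :: map target p else [::].

Definition is_path p : bool :=
  [&& p != [::], sorted (fun x y => target x == origin y) p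
    & uniq (path_vertices p)].

Definition path_darts p : {set P} := [set x | (x \in p) || (edge x \in p)].

Definition adjacent p x : bool :=
  (x \notin path_darts p) &&
  ((origin x \in path_vertices p) || (target x \in path_vertices p)).

(* The dart, originating from a vertex of p, of the edge of x, when this edge
   is adjacent to p. *)
Definition branch_dart p x : P :=
  if origin x \in path_vertices p then x else edge x.

Definition branch_index p x : nat :=
  index (origin (branch_dart p x)) (path_vertices p).

Definition left_branch p x : bool :=
  let y := branch_dart p x in
  let j := branch_index p x in
  ((j < size p) && (ccw (nth y p j) == y)) ||
  ((0 < j <= size p) && (ccw y == edge (nth y p j.-1))).

Definition branch_value p x : nat :=
  let j := branch_index p x in
  if left_branch p x then j else 2 * size p - j.

Definition branch_offset p x : nat :=
  if left_branch p x then branch_value p x else branch_value p x - size p.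

Definition first_adjacent p r : option P :=
  ohead [seq x <- r | adjacent p x].

(* k is the distance between the sets of vertices X and Y. *)
Definition is_distance (X Y : seq {set P}) (k : nat) : Prop :=
  (exists u (t : seq {set P}),
     [/\ u \in X, path adj u t, last u t \in Y & size t = k]) /\
  (forall u (t : seq {set P}),
     u \in X -> path adj u t -> last u t \in Y -> k <= size t).

Variable c : P -> 'Z_3.
Implicit Type q : 'Z_3.

Definition class_path q p : bool := is_path p && all (fun x => c x == q) p.

Definition maximal_class_path q p : Prop :=
  class_path q p /\ forall r, class_path q r -> infix p r -> r = p.

(* The oriented path p is [A,q], for a vertex A of degree 3. *)
Definition is_ray A q p : Prop :=
  [/\ A \in vertices, degree A = 3, maximal_class_path q p &
      ohead (path_vertices p) = Some A].

Definition opposite_rays A C q p p' : Prop :=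
  [/\ is_ray A q p, is_ray C q p' & path_darts p != path_darts p'].

(* The quantities M(q), K(q), S^+(q), S^-(q) do not depend on the choice of
   the ends A and C; each is given here as the relation "the value is obtained
   for some choice of A and C". *)
Definition is_M q (m : nat) : Prop :=
  exists A p, is_ray A q p /\ size p = m.

Definition is_K q (k : nat) : Prop :=
  exists A C p p', opposite_rays A C q p p' /\
    is_distance (path_vertices p) (path_vertices p') k.

Definition is_S q q' (n : nat) : Prop :=
  exists A C p p' r f,
    [/\ opposite_rays A C q p p', is_ray C q' r,
        first_adjacent p r = Some f & branch_offset p f = n].

Definition is_Splus q : nat -> Prop := is_S q (q + 1)%R.
Definition is_Sminus q : nat -> Prop := is_S q (q - 1)%R.

End Maps.

(* Main.v *)
Require Import Defs.
From HB Require Import structures.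
From mathcomp Require Import all_boot all_order all_algebra all_fingroup.
From mathcomp Require Import zify ring.

Set Implicit Arguments.
Unset Strict Implicit.
Unset Printing Implicit Defensive.

Import GRing.Theory.

(** Since all degrees divide 6, the faces are triangles and [edge] is an
involution, the darts of P carry an action of the orientation-preserving
symmetries of the triangular lattice: translations along the lattice act by
going straight on through the vertices.  Developing P from a dart at a vertex of
degree 3 gives a covering of P by the lattice.  The points over vertices of
degree 3 form a sublattice L, and two points lie over the same vertex exactly
when they are equal or opposite modulo 2L; this uses that [edge] has no fixed
point, and makes the sphere the quotient of the plane by half-turns about the
points of L.

Let e_0, e_1, e_2 = e_1 - e_0 be unit vectors in the directions of the classes
q, q+1, q+2.  A maximal path of class q develops onto a line in direction e_0
through a point of L, so that M(q) is the order of e_0 modulo L, and K(q) is the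
spacing of those lines; moreover S^+(q) e_0 + K(q) e_1 and
(S^-(q) - K(q)) e_0 + K(q) e_1 lie in L.  Hence L is generated by M(q) e_0 and
S^+(q) e_0 + K(q) e_1, so K(q+1) = d, and b times the second generator minus a
times the first is -d e_0 + b K(q) e_1.  It must be congruent modulo
M(q+1) e_1 to -K(q+1) e_0 + S^-(q+1) e_1, and both coefficients of e_1 lie
between 1 and M(q+1). *)

(** * Integer powers in finite groups *)

Section IntegerPowers.

Variable gT : finGroupType.
Implicit Types (g h : gT) (m n : int).
Local Open Scope group_scope.

Definition expgz g n := match n with Posz m => g ^+ m | Negz m => g ^- m.+1 end.

Lemma expgzS g n : expgz g (n + 1)%R = expgz g n * g.
Proof.
case: n => [m|[|m]] /=.
- by rewrite addn1 expgSr.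
- by rewrite mulVg.
- by rewrite subn1 [in RHS]expgS invMg mulgKV.
Qed.

Lemma expgzD g m n : expgz g (m + n)%R = expgz g m * expgz g n.
Proof.
have pos (k : nat) : forall m, expgz g (m + k%:Z)%R = expgz g m * g ^+ k.
  elim: k => [|k IHk] i; first by rewrite addr0 mulg1.
  by rewrite -addn1 PoszD addrA expgzS IHk expgD mulgA.
case: n => k /=; first exact: pos.
apply: (mulIg (g ^+ k.+1)); rewrite mulgKV -pos; congr expgz; lia.
Qed.

Lemma expgz_conj g h n : expgz (g ^ h) n = expgz g n ^ h.
Proof. by case: n => n /=; rewrite ?conjVg -conjXg. Qed.

Lemma commute_expgz g h n : commute g h -> commute g (expgz h n).
Proof. by case: n => n gh /=; [apply: commuteX | apply/commuteV/commuteX]. Qed.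

Lemma expgzM g h n : commute g h -> expgz (g * h) n = expgz g n * expgz h n.
Proof.
move=> gh; case: n => n /=; rewrite expgMn // invMg.
by apply: commuteV; apply: commute_sym; apply: commuteV; apply: commuteX2.
Qed.

Lemma expgzN g n : expgz g (- n)%R = (expgz g n)^-1.
Proof. by apply: (mulIg (expgz g n)); rewrite -expgzD addNr mulVg. Qed.

Lemma expgzV g n : expgz g^-1 n = expgz g (- n)%R.
Proof. by rewrite expgzN; case: n => n /=; rewrite expgVn. Qed.

Lemma expgz_order g : expgz g #[g] = 1.
Proof. exact: expg_order. Qed.

End IntegerPowers.

(** * Sublattices of the plane *)

Lemma ohead_filterP (T : eqType) (a : pred T) (s : seq T) (x0 y : T) :
  ohead (filter a s) = Some y -> exists n : nat,
    [/\ n < size s, y = nth x0 s n, a y & forall l, l < n -> ~~ a (nth x0 s l)].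
Proof.
elim: s => // z s IHs /=; case: ifPn => [az [<-]|naz /IHs [n [ns -> an minn]]].
  by exists 0.
by exists n.+1; split=> // -[|l] //= /minn.
Qed.

Lemma small_multiple (d : nat) (y z : int) :
  (y * d%:Z = z)%R -> (`|z| < d%:Z)%R -> z = 0%R.
Proof.
move=> <- yd; have [y0|[y0|y0]] : (y = 0 \/ 0 < y \/ y < 0)%R by lia.
- by rewrite y0 mul0r.
- by nia.
by nia.
Qed.

Section Sublattices.

Local Open Scope ring_scope.

Lemma int_subgroup_mul (Q : pred int) i n :
  (forall i j, Q i -> Q j -> Q (i - j)) -> Q i -> Q (n * i).
Proof.
move=> QB Qi; have Q0 : Q 0 by rewrite -(subrr i) QB.
have QN j : Q j -> Q (- j) by rewrite -sub0r => /(QB _ _ Q0).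
elim/int_rect: n => [|n IHn|n IHn]; first by rewrite mul0r.
  by rewrite intS mulrDl mul1r addrC -[i in _ + i]opprK QB // QN.
by rewrite intS opprD mulrDl mulN1r addrC QB.
Qed.

Lemma int_subgroupP (Q : pred int) :
  (forall i j, Q i -> Q j -> Q (i - j)) -> (exists2 n : nat, (0 < n)%N & Q n%:Z) ->
  exists m : nat, (0 < m)%N /\ forall i, Q i = (m%:Z %| i)%Z.
Proof.
move=> QB [n n0 Qn].
have exn : exists n : nat, (0 < n)%N && Q n%:Z by exists n; rewrite n0.
case: (ex_minnP exn) => m /andP [m0 Qm] minm; exists m; split=> // i.
apply/idP/dvdzP => [Qi|[a ->]]; last exact: int_subgroup_mul.
exists (i %/ m)%Z; rewrite {1}(divz_eq i m) -[RHS]addr0; congr (_ + _).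
have Qr : Q (i %% m)%Z.
  by rewrite /modz QB // int_subgroup_mul.
have r0 : 0 <= (i %% m)%Z by rewrite modz_ge0; lia.
have rm : (i %% m)%Z < m by rewrite ltz_pmod.
case: (posnP `|(i %% m)%Z|) => [|r1]; first by lia.
have := minm `|(i %% m)%Z|%N; rewrite r1 gez0_abs // Qr => /(_ isT); lia.
Qed.

(* For the sublattice L of the vertices of degree 3, in coordinates whose first
   axis has class q, [row_period] characterizes M(q) and [row_spacing] K(q). *)
Definition row_period (L : int -> int -> bool) (m : nat) : Prop :=
  (0 < m)%N /\ forall i, L i 0 = (m%:Z %| i)%Z.

Definition row_spacing (L : int -> int -> bool) (k : nat) : Prop :=
  [/\ (0 < k)%N, exists s, L s k%:Z & forall i j, L i j -> (k%:Z %| j)%Z].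

Lemma row_period_eq (L L' : int -> int -> bool) n :
  (forall i j, L' i j = L i j) -> row_period L n -> row_period L' n.
Proof. by move=> e [n0 Ln]; split=> // i; rewrite e. Qed.

Lemma row_spacing_eq (L L' : int -> int -> bool) n :
  (forall i j, L' i j = L i j) -> row_spacing L n -> row_spacing L' n.
Proof.
move=> e [n0 [s Ls] dn]; split=> // [|i j]; last by rewrite e; apply: dn.
by exists s; rewrite e.
Qed.

Variable L : int -> int -> bool.
Hypothesis LB : forall i j a b, L i j -> L a b -> L (i - a) (j - b).

Lemma sublatticeZ n i j : L i j -> L (n * i) (n * j).
Proof.
move=> Lij; have := @int_subgroup_mul (fun n => L (n * i) (n * j)) 1 n.
by rewrite mulr1 !mul1r; apply=> // a b La Lb; rewrite !mulrBl LB.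
Qed.

Lemma row_period_ex :
  (exists2 n : nat, (0 < n)%N & L n%:Z 0) -> exists m, row_period L m.
Proof.
by move=> h; apply: (int_subgroupP (Q := L^~ 0)) => // i j Li /(LB Li); rewrite subrr.
Qed.

Lemma row_spacing_ex m :
  row_period L m -> (exists2 n : nat, (0 < n)%N & L 0 n%:Z) ->
  exists k, row_spacing L k.
Proof.
(* [Q] is the projection of [L] to the second axis; subtracting multiples of (m, 0) bounds the first
   coordinate, which keeps the predicate boolean. *)
case=> m0 Lm Ln; pose Q j := [exists s : 'I_m, L s%:Z j].
have QP i j : L i j -> Q j.
  move=> Lij; have r0 : 0 <= (i %% m)%Z by rewrite modz_ge0; lia.
  have rm : (i %% m)%Z < m by rewrite ltz_pmod.
  have rm' : (`|(i %% m)%Z| < m)%N by lia.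
  apply/existsP; exists (Ordinal rm'); rewrite /= gez0_abs // /modz -[j]subr0 LB //.
  by rewrite Lm dvdz_mull.
have [i j||k [k0 Qk]] := @int_subgroupP Q.
- by move=> /existsP [s Ls] /existsP [t Lt]; apply: QP (LB Ls Lt).
- by case: Ln => n n0 /QP; exists n.
exists k; split=> // [|i j /QP]; last by rewrite Qk.
by have /existsP [s] : Q k by [rewrite Qk dvdzz]; exists s.
Qed.

Lemma row_period_uniq m m' : row_period L m -> row_period L m' -> m = m'.
Proof.
move=> [m0 Lm] [m0' Lm']; apply/eqP; rewrite eqn_dvd.
have := dvdzz m; rewrite -Lm Lm'; have := dvdzz m'; rewrite -Lm' Lm => mm m'm.
by apply/andP; split.
Qed.

Lemma row_spacing_uniq k k' : row_spacing L k -> row_spacing L k' -> k = k'.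
Proof.
move=> [k0 [s Ls] dk] [k0' [s' Ls'] dk']; apply/eqP; rewrite eqn_dvd.
by apply/andP; split; [apply: dk Ls' | apply: dk' Ls].
Qed.

End Sublattices.

(** * Sublattice invariants of two consecutive classes *)

Section AdjacentRowClasses.

Local Open Scope ring_scope.

(* In the basis (e_1, e_2) = (e_1, e_1 - e_0), the vector with coordinates
   (i, j) is - j e_0 + (i + j) e_1. *)
Lemma change_of_basis (L L' : int -> int -> bool) (m k s m' k' sp sm d a b : nat) :
  (forall i j a b, L i j -> L a b -> L (i - a) (j - b)) ->
  (forall i j, L' i j = L (- j) (i + j)) ->
  row_period L m -> row_spacing L k -> L s%:Z k%:Z ->
  row_period L' m' -> row_spacing L' k' -> L' sp%:Z k'%:Z ->
  (0 < sm <= m')%N -> L' (sm%:Z - k'%:Z) k'%:Z ->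
  d = gcdn s m -> (0 < b)%N -> (a * m)%:Z - (b * s)%:Z = d%:Z -> (b <= m %/ d)%N ->
  sm = (b * k)%N /\ (sp%:Z = (b * k)%:Z - k'%:Z %[mod m'])%Z.
Proof.
move=> LB eL' [m0 Lm] [k0 _ dk] Lsk [m0' Lm'] [k0' [t Lt] dk'] Lsp sm_bnd Lsm.
move=> ed b0 eab bd.
have d0 : (0 < d)%N by rewrite ed gcdn_gt0 m0 orbT.
have dm : (d %| m)%N by rewrite ed dvdn_gcdr.
have ds : (d %| s)%N by rewrite ed dvdn_gcdl.
rewrite eL' in Lt; rewrite eL' in Lsp; rewrite eL' in Lsm.
have LZ := sublatticeZ LB.
have dvdzN (p r : int) : (p %| - r)%Z = (p %| r)%Z by rewrite !dvdzE abszN.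
have sub0 i j i' j' : L i j -> L i' j' -> i = i' -> (m'%:Z %| j - j')%Z.
  move=> Lij Lij' ii; rewrite -Lm' eL' addr0; have := LB _ _ _ _ Lij Lij'.
  by rewrite ii subrr oppr0.
have k'dvd x y : L x y -> (k'%:Z %| x)%Z.
  move=> Lxy; rewrite -dvdzN; apply: (dk' (x + y)).
  by rewrite eL' opprK addrAC subrr add0r.
(* Up to sign, second coordinates in [L'] are first coordinates in [L]. As [L] is generated by (m,
   0) and (s, k), these form the subgroup generated by m and s. *)
have kd : k' = d.
  apply/eqP; rewrite eqn_dvd {1}ed dvdn_gcd; apply/andP; split.
    have Lm0 : L m%:Z 0 by rewrite Lm dvdzz.
    by move: (k'dvd _ _ Lsk) (k'dvd _ _ Lm0); rewrite !dvdzE /= => -> ->.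
  have /dvdzP [u eu] := dk _ _ Lt.
  have : L (- k'%:Z - u * s%:Z) 0.
    by have := LB _ _ _ _ Lt (LZ u _ _ Lsk); rewrite eu subrr.
  rewrite Lm => /dvdzP [v ev]; case/dvdnP: dm => x ex; case/dvdnP: ds => y ey.
  suff : (d%:Z %| k'%:Z)%Z by rewrite dvdzE.
  apply/dvdzP; exists (- u * y%:Z - v * x%:Z).
  by rewrite mulrBl -!mulrA -!PoszM -ex -ey -ev; ring.
have Lbk : L (- d%:Z) (b * k)%:Z.
  have Lm0 : L m%:Z 0 by rewrite Lm dvdzz.
  have := LB _ _ _ _ (LZ b%:Z _ _ Lsk) (LZ a%:Z _ _ Lm0).
  by rewrite mulr0 subr0 -eab opprB !PoszM.
(* With m' = u k, subtracting u (s, k) from (0, m') gives m | u s. Since d = a m - b s, also m | u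
   d, whence b <= m / d <= u. *)
have bk : (b * k <= m')%N.
  have : L 0 m'%:Z by have := Lm' m'; rewrite dvdzz eL' addr0 oppr0 => ->.
  move=> Lm'0; have /dvdnP [u eu] : (k %| m')%N by have := dk _ _ Lm'0; rewrite dvdzE.
  have mus : (m %| u * s)%N.
    have := LB _ _ _ _ Lm'0 (LZ u%:Z _ _ Lsk).
    by rewrite eu PoszM subrr Lm sub0r dvdzN -PoszM dvdzE.
  have mud : (m %| u * d)%N.
    suff : (m%:Z %| (u * d)%:Z)%Z by rewrite dvdzE.
    case/dvdnP: mus => v ev; apply/dvdzP; exists (u%:Z * a%:Z - b%:Z * v%:Z).
    have {ev}ev : u%:Z * s%:Z = v%:Z * m%:Z by rewrite -!PoszM ev.
    by rewrite mulrBl -[b%:Z * _ * _]mulrA -ev PoszM -eab !PoszM; ring.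
  rewrite eu leq_mul2r; apply/orP; right; apply: leq_trans bd _.
  rewrite dvdn_leq //; first by case: u eu {mus mud} => // eu; lia.
  by rewrite -(dvdn_pmul2r d0) divnK.
(* Two vectors of [L] with first coordinate -d have second coordinates congruent modulo m'; here
   both lie between 1 and m'. *)
have smE : sm = (b * k)%N.
  have := sub0 _ _ _ _ Lsm Lbk; rewrite kd subrK => /(_ erefl) /dvdzP [u eu].
  case/andP: sm_bnd => sm0 smm; have bk0 : (0 < b * k)%N by rewrite muln_gt0 b0.
  have u0 : u = 0 by nia.
  by move: eu; rewrite u0 mul0r; lia.
split=> //; apply/eqP; rewrite eqz_mod_dvd -smE.
have := sub0 _ _ _ _ Lsp Lsm erefl; congr (_ %| _)%Z; ring.
Qed.

End AdjacentRowClasses.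

(** * Translations in the triangle group (2, 3, 6) *)

Section TriangleGroup.

Variables (gT : finGroupType) (R E : gT).
Local Open Scope group_scope.
Hypotheses (rot6 : R ^+ 6 = 1) (flip2 : E * E = 1) (turn3 : (E * R^-1) ^+ 3 = 1).

(** Products of permutations apply the left factor first: cross the edge, then make a half-turn, so
    as to face straight ahead. *)
Definition straight : gT := E * R ^+ 3.
Definition slant : gT := R * straight * R^-1.
Definition shift (i j : int) : gT := expgz straight i * expgz slant j.

Let rot3 : R ^+ 3 = R * (R * R). Proof. by []. Qed.

Let rot5 g : R * (R * (R * (R * (R * g)))) = R^-1 * g.
Proof.
apply: (mulgI R); rewrite mulKVg -[RHS]mul1g -rot6.
by rewrite !expgSr expg0 mul1g -!mulgA.
Qed.

Let flipK g : E * (E * g) = g.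
Proof. by rewrite mulgA flip2 mul1g. Qed.

(** The face relation as E R^-1 E = R E R; the trailing [g] lets it rewrite inside right-associated
    words. *)
Let flip_rotV_flip g : E * (R^-1 * (E * g)) = R * (E * (R * g)).
Proof.
apply: (mulgI (E * R^-1)); rewrite -!mulgA mulKg flipK.
by rewrite -[RHS]mul1g -turn3 !expgSr expg0 mul1g -!mulgA !mulKg.
Qed.

Let flip_rot_flip g : E * (R * (E * g)) = R^-1 * (E * (R^-1 * g)).
Proof. by apply: (mulgI R); rewrite mulKVg -flip_rotV_flip flipK. Qed.

Let slantE : slant = R * (E * (R * R)).
Proof. by rewrite /slant /straight rot3 -!mulgA mulgV mulg1. Qed.

(** Conjugation by R turns translations by 60 degrees; this is the relation e_2 = e_1 - e_0. *)
Lemma slantJ : R * slant * R^-1 = straight^-1 * slant.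
Proof.
apply: (mulgI straight); rewrite mulKVg slantE /straight rot3 -!mulgA mulgV mulg1.
by rewrite rot5 flip_rotV_flip.
Qed.

Lemma commute_straight_slant : commute straight slant.
Proof.
suff h : commute straight (straight^-1 * slant).
  by rewrite -(mulKVg straight slant); apply: commuteM.
rewrite /commute mulKVg -slantJ slantE /straight rot3 -!mulgA mulKVg.
by rewrite flip_rot_flip mulKVg mulKg.
Qed.

Lemma commute_pow_straight_slant i j : commute (expgz straight i) (expgz slant j).
Proof.
apply: commute_expgz; apply: commute_sym; apply: commute_expgz.
exact/commute_sym/commute_straight_slant.
Qed.

Lemma shiftD i i' j j' : shift (i + i')%R (j + j')%R = shift i j * shift i' j'.
Proof.
rewrite /shift !expgzD !mulgA; congr (_ * _); rewrite -!mulgA; congr (_ * _).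
exact: commute_pow_straight_slant.
Qed.

Lemma rot_shift i j : R * shift i j = shift (- j)%R (i + j)%R * R.
Proof.
have conjR g : R * g = g ^ (R^-1) * R by rewrite conjgE invgK !mulgA mulgKV.
rewrite conjR; congr (_ * _); rewrite /shift conjMg -!expgz_conj.
have -> : straight ^ R^-1 = slant by rewrite conjgE invgK mulgA.
have -> : slant ^ R^-1 = straight^-1 * slant by rewrite conjgE invgK mulgA slantJ.
rewrite (expgzM _ (commute_sym (commuteV (commute_sym commute_straight_slant)))).
by rewrite expgzV expgzD !mulgA commute_pow_straight_slant.
Qed.

Lemma shift00 : shift 0 0 = 1.
Proof. by rewrite /shift mulg1. Qed.

Lemma flip_shift : E = shift 1 0 * R ^+ 3.
Proof. by rewrite /shift /straight mulg1 /= expg1 -mulgA -expgnDr rot6 mulg1. Qed.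

End TriangleGroup.

(** * The developing map *)

Section Development.

Variables (P : gmap) (c : P -> 'Z_3).
Hypotheses (hP : family_P P) (hc : class_partition c).
Implicit Types (x y z : P) (i j : int) (k : nat).

Local Notation R := (@ccw P).
Local Notation E := (@edge P).

Lemma ccw6 : (R ^+ 6 = 1)%g.
Proof.
apply/permP => x; rewrite permX perm1.
have /(family_degree hP) [dx|dx] : porbit R x \in vertices P by apply/imsetP; exists x.
  by rewrite (iterD 3 3) -dx !iter_porbit.
by rewrite -dx iter_porbit.
Qed.

Lemma edge2 : (E * E = 1)%g.
Proof. by apply/permP => x; rewrite permM perm1 edgeK. Qed.

Lemma face3 : (face P ^+ 3 = 1)%g.
Proof.
apply/permP => x; rewrite permX perm1.
by rewrite -{1}(family_triangulation hP x) iter_porbit.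
Qed.

Local Notation shift := (shift R E).

(* The developing map: the image in P of the dart of the triangular lattice that
   leaves the point (i, j) in direction [k] (in steps of 60 degrees), when the
   dart of direction 0 at the point (0, 0) is sent to [x].  The directions 0, 1
   and 2 are (1, 0), (0, 1) and (-1, 1). *)
Definition develop x i j k : P := (shift i j * R ^+ k)%g x.

Lemma developE x : x = develop x 0 0 0.
Proof. by rewrite /develop shift00 mul1g perm1. Qed.

Lemma develop_ccw x i j k : ccw (develop x i j k) = develop x i j k.+1.
Proof. by rewrite /develop expgSr mulgA [in RHS]permM. Qed.

Lemma develop6 x i j k : develop x i j (k + 6) = develop x i j k.
Proof. by rewrite /develop expgnDr ccw6 mulg1. Qed.

Lemma develop_base x i j i' j' k :
  develop (develop x i j 0) i' j' k = develop x (i + i')%R (j + j')%R k.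
Proof. by rewrite /develop (shiftD ccw6 edge2 face3) mulg1 !permM. Qed.

Lemma develop_rot x i j k :
  develop (ccw x) i j k = develop x (- j)%R (i + j)%R k.+1.
Proof. by rewrite /develop -permM mulgA (rot_shift ccw6 edge2 face3) -mulgA -expgS. Qed.

Lemma develop_rot3 x i j k :
  develop ((R ^+ 3)%g x) i j k = develop x (- i)%R (- j)%R (k + 3).
Proof.
rewrite !expgS expg0 mulg1 !permM !develop_rot addnC; congr develop; lia.
Qed.

Lemma develop_edge0 x i j : edge (develop x i j 0) = develop x (i + 1)%R j 3.
Proof.
rewrite /develop -{2}[j]addr0 (shiftD ccw6 edge2 face3) mulg1.
by rewrite -mulgA -(flip_shift _ ccw6) [RHS]permM.
Qed.

Lemma develop_edge1 x i j : edge (develop x i j 1) = develop x i (j + 1)%R 4.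
Proof.
have -> k : develop x i j k.+1 = develop (ccw x) (i + j)%R (- i)%R k.
  by rewrite develop_rot; congr develop; lia.
rewrite develop_edge0 develop_rot; congr develop; lia.
Qed.

Lemma develop_edge2 x i j : edge (develop x i j 2) = develop x (i - 1)%R (j + 1)%R 5.
Proof.
have -> k : develop x i j k.+1 = develop (ccw x) (i + j)%R (- i)%R k.
  by rewrite develop_rot; congr develop; lia.
rewrite develop_edge1 develop_rot; congr develop; lia.
Qed.

Lemma class_expgz (s : {perm P}) n x :
  (forall y, c (s y) = c y) -> c (expgz s n x) = c x.
Proof.
move=> cs; have pos m z : c ((s ^+ m)%g z) = c z.
  by elim: m z => [|m IHm] z; rewrite ?perm1 // expgSr permM cs IHm.
case: n => m //=; rewrite -[in RHS](permKV (s ^+ m.+1)%g x) pos //.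
Qed.

(** Going straight turns by three steps, and 3 = 0 in 'Z_3, so translations preserve classes and
    only the direction counts. *)
Lemma class_develop x i j k : c (develop x i j k) = (c x + k%:R)%R.
Proof.
have [cE cR] := hc.
have cRn n z : c ((R ^+ n)%g z) = (c z + n%:R)%R.
  elim: n z => [|n IHn] z; first by rewrite perm1 addr0.
  by rewrite expgSr permM cR IHn -addrA -[n.+1]addn1 natrD.
have cS z : c (straight R E z) = c z.
  rewrite permM cRn cE (_ : 3%:R = 0 :> 'Z_3)%R ?addr0 //; exact: val_inj.
rewrite /develop permM cRn /shift permM !class_expgz // => z.
rewrite /slant 2!permM -[in RHS](addrK 1%R (c z)) -cR -(cS (R z)).
by rewrite -[in RHS](permKV R (straight R E (R z))) cR addrK.
Qed.

Lemma modn3_class k : (k%:R == 0 :> 'Z_3)%R = (3 %| k).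
Proof. by rewrite -val_eqE /= val_Zp_nat. Qed.

Lemma origin_ccwn n z : origin ((R ^+ n)%g z) = origin z.
Proof. by apply/eqP; rewrite eq_porbit_mem mem_porbit. Qed.

Lemma origin_develop x i j k : origin (develop x i j k) = origin (develop x i j 0).
Proof. by rewrite /develop permM origin_ccwn mulg1. Qed.

Lemma dart_of_origin x i j z :
  origin z = origin (develop x i j 0) -> exists k, z = develop x i j k.
Proof.
move/eqP; rewrite eq_porbit_mem => /porbitP [k ->].
by exists k; rewrite /develop mulg1 -permM.
Qed.

(** Directions 3 to 5 reverse directions 0 to 2. The bound on b, at most one row per edge, yields
    the lower bound on K(q) through path lifting. *)
Lemma develop_edge x k : exists a b : int, (`|b| <= 1)%R /\
  forall i j, edge (develop x i j k) = develop x (i + a)%R (j + b)%R (k + 3).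
Proof.
have base k' : k' < 3 -> exists a b : int, (`|b| <= 1)%R /\
    forall i j, edge (develop x i j k') = develop x (i + a)%R (j + b)%R (k' + 3).
  case: k' => [|[|[|//]]] _.
  - by exists 1%R, 0%R; split=> // i j; rewrite develop_edge0 addr0.
  - by exists 0%R, 1%R; split=> // i j; rewrite develop_edge1 addr0.
  - by exists (-1)%R, 1%R; split=> // i j; rewrite develop_edge2.
have base6 k' : k' < 6 -> exists a b : int, (`|b| <= 1)%R /\
    forall i j, edge (develop x i j k') = develop x (i + a)%R (j + b)%R (k' + 3).
  case: (ltnP k' 3) => [k3 _|k3 k6]; first exact: base.
  have [|a [b [b1 ab]]] := base (k' - 3); first by lia.
  exists (- a)%R, (- b)%R; split=> [|i j]; first by lia.
  have := ab (i - a)%R (j - b)%R; rewrite !subrK (subnK k3) => <-.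
  by rewrite edgeK -[LHS]develop6; congr develop; rewrite -[6]/(3 + 3) addnA subnK.
rewrite (divn_eq k 6); elim: (k %/ 6)%N => [|n [a [b [b1 ab]]]].
  by apply: base6; rewrite ltn_mod.
have -> : (n.+1 * 6 + k %% 6 = n * 6 + k %% 6 + 6)%N by rewrite mulSn; lia.
by exists a, b; split=> // i j; rewrite develop6 ab -[LHS]develop6 -!addnA (addnC 3).
Qed.

Lemma adj_path_lift x (t : seq {set P}) i j :
  path (@adj P) (origin (develop x i j 0)) t ->
  exists i' j', last (origin (develop x i j 0)) t = origin (develop x i' j' 0)
    /\ (`|j' - j| <= (size t)%:Z)%R.
Proof.
elim: t i j => [|u t IHt] i j /=; first by exists i, j; split=> //; lia.
case/andP=> /existsP [z /andP [/eqP oz /eqP ->]] pt.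
have [k zk] := dart_of_origin (esym oz).
have [a [b [b1 ab]]] := develop_edge x k.
move: pt; rewrite /target zk ab origin_develop => /IHt [i' [j' [-> jj]]].
exists i', j'; split=> //; lia.
Qed.

Lemma develop_surj x z : exists i j k, z = develop x i j k.
Proof.
have [_ [conP _] _ _ _] := hP.
have vtx y : origin y \in vertices P by apply/imsetP; exists y.
have /connectP [t] := conP _ _ (vtx x) (vtx z).
rewrite {1 2}(developE x) => /adj_path_lift [i [j [-> _]]] /dart_of_origin [k ->].
by exists i, j, k.
Qed.

Lemma develop_ccwn x i j k n : (R ^+ n)%g (develop x i j k) = develop x i j (k + n).
Proof. by rewrite /develop -permM -mulgA -expgnDr. Qed.

Lemma develop_mod3 x i j k k' : k = k' %[mod 3] ->
  develop x i j k = develop x i j k' \/ develop x i j k = develop x i j (k' + 3).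
Proof.
have mul6 n r : develop x i j (n * 6 + r) = develop x i j r.
  by elim: n => [|n IHn] //; rewrite mulSn -addnA addnC develop6.
move=> kk'; rewrite (divn_eq k 6) (divn_eq k' 6) -addnA !mul6.
have := ltn_pmod k (isT : 0 < 6); have := ltn_pmod k' (isT : 0 < 6).
have : k %% 6 = k' %% 6 %[mod 3] by rewrite !modn_dvdm.
case: (k %% 6)%N => [|[|[|[|[|[|//]]]]]];
  case: (k' %% 6)%N => [|[|[|[|[|[|//]]]]]] //= _ _ _;
  by [left | right | right; rewrite -[LHS]develop6].
Qed.

Lemma class_develop_eq x i j k i' j' k' :
  c (develop x i j k) = c (develop x i' j' k') -> k = k' %[mod 3].
Proof.
rewrite !class_develop => /addrI /eqP.
wlog kk' : k k' / k <= k'.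
  by move=> h; case: (leqP k k') => [/h//|/ltnW /h h' /eqP e]; apply/esym/h'/eqP.
by rewrite eq_sym -subr_eq0 -natrB // modn3_class -eqn_mod_dvd // => /eqP ->.
Qed.

(* When the origin of [x] has degree 3, [half_period x] is the set of the lattice
   points sent to the vertices of degree 3, and [period x] is its double. *)
Definition period x i j : bool := develop x i j 0 == x.
Definition half_period x i j : bool := period x (i + i)%R (j + j)%R.

Lemma develop_period x i j a b k :
  period x a b -> develop x (i + a)%R (j + b)%R k = develop x i j k.
Proof.
move=> /eqP xab.
have -> : develop x i j k = develop (develop x a b 0) i j k by rewrite xab.
by rewrite develop_base addrC [(b + j)%R]addrC.
Qed.

Lemma period_develop x i j i' j' k :
  develop x i j k = develop x i' j' k -> period x (i - i')%R (j - j')%R.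
Proof.
move=> e; apply/eqP/(@perm_inj _ (shift i' j' * R ^+ k)%g).
have -> y : (shift i' j' * R ^+ k)%g y = develop y i' j' k by [].
by rewrite develop_base subrK subrK.
Qed.

Lemma periodB x i j a b : period x i j -> period x a b -> period x (i - a)%R (j - b)%R.
Proof.
move=> /eqP xij /eqP xab; apply: (@period_develop _ _ _ _ _ 0).
by rewrite xij xab.
Qed.

Lemma half_periodB x i j a b :
  half_period x i j -> half_period x a b -> half_period x (i - a)%R (j - b)%R.
Proof.
by move=> h /(periodB h); rewrite /half_period (addrACA i) (addrACA j) -!opprD.
Qed.

Lemma period_base x a b i j : period (develop x a b 0) i j = period x i j.
Proof.
apply/eqP/idP; last by rewrite develop_base; apply: develop_period.
rewrite develop_base => /period_develop.
by rewrite addrAC subrr add0r addrAC subrr add0r.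
Qed.

Lemma period_ccw x i j : period (ccw x) i j = period x (- j)%R (i + j)%R.
Proof. by rewrite /period develop_rot -develop_ccw (inj_eq perm_inj). Qed.

Lemma half_period_ccw x i j : half_period (ccw x) i j = half_period x (- j)%R (i + j)%R.
Proof. by rewrite /half_period period_ccw opprD addrACA. Qed.

Lemma ccw3_degree3 x : degree (origin x) = 3 -> (R ^+ 3)%g x = x.
Proof. by move=> dx; rewrite permX -dx iter_porbit. Qed.

Section HalfTurn.

Variable x : P.
Hypothesis x3 : (R ^+ 3)%g x = x.
Local Notation D := (develop x).

(** Since R^3 fixes the base dart, the half-turn about (0, 0) is a symmetry of the covering. *)
Lemma develop_opp i j k : D i j (k + 3) = D (- i)%R (- j)%R k.
Proof. by rewrite -{2}x3 develop_rot3 !opprK. Qed.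

(** The equation on darts characterizes degree 3 at the vertex below (i, j). The half-turn moves its
    left side to (-i, -j), direction 0. *)
Lemma half_periodP i j : half_period x i j <-> D i j 3 = D i j 0.
Proof.
rewrite (develop_opp _ _ 0).
split=> [/(develop_period (- i)%R (- j)%R 0)|/esym/period_develop].
  by rewrite !addrA !addNr !add0r => ->.
by rewrite !opprK.
Qed.

(* A translation by a vector outside 2 Z^2, composed with the half-turn about
   (0, 0), would be a half-turn about the midpoint of an edge, so that [edge]
   would have a fixed point. *)
Lemma even_period i j : period x i j ->
  exists a b, [/\ i = (a + a)%R, j = (b + b)%R & half_period x a b].
Proof.
move=> pij.
(* If (i, j) = 2 (a, b) + (s, t) with (s, t) an edge vector, the half-turn about the midpoint of
   that edge preserves [D], so the edge dart equals its reverse. *)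
have odd_step a b s t d : edge (D a b d) = D (a + s)%R (b + t)%R (d + 3) ->
    i = (a + a + s)%R -> j = (b + b + t)%R -> False.
  move=> e ei ej; have := develop_period (- a)%R (- b)%R d pij.
  rewrite -develop_opp ei ej !addrA !addNr !add0r => /(congr1 (R ^+ 3)%g).
  rewrite !develop_ccwn -e -addnA develop6; apply/eqP/edge_neq.
have [a ia] : exists a, i = (a + a)%R \/ i = (a + a + 1)%R.
  by exists (i %/ 2)%Z; lia.
have [b jb] : exists b, j = (b + b)%R \/ j = (b + b + 1)%R.
  by exists (j %/ 2)%Z; lia.
case: ia jb => ia [] jb.
- by exists a, b; split=> //; rewrite /half_period -ia -jb.
- by case: (odd_step a b 0%R 1%R 1) => //; rewrite ?develop_edge1 addr0.
- by case: (odd_step a b 1%R 0%R 0) => //; rewrite ?develop_edge0 addr0.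
(* Both coordinates odd: the edge joins (a + 1, b) to (a, b + 1), in direction 2. *)
case: (odd_step (a + 1)%R b (- 1)%R 1%R 2) => //; first by rewrite develop_edge2.
lia.
Qed.

(** Comparing classes leaves direction 0 or 3 for the common dart; direction 3 becomes 0 at the
    opposite point. *)
Lemma origin_develop_eq i j i' j' : origin (D i j 0) = origin (D i' j' 0) ->
  period x (i - i')%R (j - j')%R \/ period x (i + i')%R (j + j')%R.
Proof.
move/esym/dart_of_origin=> [k e]; have := class_develop_eq (congr1 c e) => k0.
have [ek|ek] := develop_mod3 x i j (esym k0); move: e; rewrite ek.
  by move/esym/period_develop; left.
rewrite develop_opp => /period_develop.
by rewrite !opprK addrC [(j' + j)%R]addrC; right.
Qed.

Lemma same_class_half_turn y : (R ^+ 3)%g y = y -> c y = c x ->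
  exists a b, y = D a b 0 /\ half_period x a b.
Proof.
move=> y3 cy; have [a [b [k ey]]] := develop_surj x y.
have [a' [b' ey']] : exists a' b', y = D a' b' 0.
  have k0 : k = 0 %[mod 3].
    by apply: (@class_develop_eq x a b k 0%R 0%R 0); rewrite -ey cy -developE.
  have [e|e] := develop_mod3 x a b k0; first by exists a, b; rewrite ey.
  by exists (- a)%R, (- b)%R; rewrite ey e develop_opp.
by exists a', b'; split=> //; apply/half_periodP; rewrite -(develop_ccwn _ _ _ 0) -ey'.
Qed.

(** P is finite, so the translation has finite order. *)
Lemma period_straight : exists2 n : nat, 0 < n & half_period x n 0.
Proof.
exists #[straight R E]%g; rewrite ?order_gt0 // /half_period /period /develop.
by rewrite /shift !expgzD expgz_order !mulg1 perm1.
Qed.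

Lemma period_slant : exists2 n : nat, 0 < n & half_period x 0 n.
Proof.
exists #[slant R E]%g; rewrite ?order_gt0 // /half_period /period /develop.
by rewrite /shift !expgzD expgz_order !mulg1 perm1.
Qed.

End HalfTurn.

(** * Rays as rows of the lattice *)

Definition row x n : seq P := mkseq (fun i : nat => develop x i 0 0) n.

Lemma size_row x n : size (row x n) = n.
Proof. exact: size_mkseq. Qed.

Lemma target_row x (i : nat) : target (develop x i 0 0) = origin (develop x i.+1 0 0).
Proof. by rewrite /target develop_edge0 origin_develop intS addrC. Qed.

Lemma path_vertices_row x n : 0 < n ->
  path_vertices (row x n) = mkseq (fun i : nat => origin (develop x i 0 0)) n.+1.
Proof.
case: n => // n _; rewrite /row /mkseq /=; congr (_ :: _).
rewrite (target_row x 0) -[1]/(0.+1); congr (_ :: _).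
rewrite -map_comp (iotaDl 1 1) -map_comp; apply: eq_map => i /=.
by rewrite target_row.
Qed.

Section Rows.

Variables (x : P) (m : nat).
Hypotheses (x3 : (R ^+ 3)%g x = x) (xm : row_period (half_period x) m).

(** Periods on the axis are multiples of 2m. For indices in [0, m], a difference divisible by 2m is
    0, and a sum divisible by 2m forces both to be 0 or both to be m. *)
Lemma uniq_path_row n : n <= m ->
  uniq (mkseq (fun i : nat => origin (develop x i 0 0)) n.+1).
Proof.
move=> nm; apply/mkseq_uniqP => i j; rewrite !inE => ile jle /(origin_develop_eq x3).
have half (t : int) : period x t 0 -> exists2 a, t = (a + a)%R & (m%:Z %| a)%Z.
  case/(even_period x3) => a [b [-> b0]]; have -> : b = 0%R by lia.
  by case: xm => _ ->; exists a.
rewrite !ltnS in ile jle; case: xm => m0 _.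
rewrite addr0; case=> /half [a ea /dvdzP [u ua]].
  have u0 : u = 0%R by nia.
  by rewrite u0 in ua; lia.
have [u0|u1] : u = 0%R \/ u = 1%R by nia.
  by rewrite u0 in ua; lia.
by rewrite u1 in ua; lia.
Qed.

Lemma class_row n : all (fun y => c y == c x) (row x n).
Proof.
by apply/allP=> y /mapP [i _ ->]; rewrite class_develop addr0.
Qed.

Lemma class_path_row n : 0 < n <= m -> class_path c (c x) (row x n).
Proof.
case/andP=> n0 nm; rewrite /class_path class_row andbT.
rewrite /is_path path_vertices_row // uniq_path_row // andbT.
apply/andP; split; first by rewrite -size_eq0 size_row -lt0n.
apply/(sortedP x) => i; rewrite size_row => i_n.
by rewrite !nth_mkseq // ?(ltnW i_n) // target_row.
Qed.

Lemma class_path_is_row p :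
  class_path c (c x) (x :: p) -> x :: p = row x (size p).+1.
Proof.
case/andP=> /and3P [_ /(sortedP x) adjp unip] clp.
suff h n : n < (size p).+1 -> nth x (x :: p) n = develop x n 0 0.
  apply: (@eq_from_nth _ x) => [|n np]; first by rewrite size_row.
  by rewrite nth_mkseq ?h.
elim: n => [|n IHn] np; first by rewrite -developE.
have {}IHn := IHn (ltnW np).
have /eqP := adjp n np; rewrite IHn target_row => /esym /dart_of_origin [k ek].
have k0 : k = 0 %[mod 3].
  apply: (@class_develop_eq x n.+1 0 k 0%R 0%R 0); rewrite -ek -developE; apply/eqP.
  by have /allP := clp; apply; apply: mem_nth.
(* Direction 0 prolongs the row; direction 3 would retrace the last edge and repeat vertex n. *)
have [e|e] := develop_mod3 x n.+1 0 k0; first by rewrite ek.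
have target_nth r : r < (size p).+1 ->
    nth set0 (path_vertices (x :: p)) r.+1 = target (nth x (x :: p) r).
  by move=> rp; rewrite -(nth_map x set0 (@target P)).
have origin_nth r : r < (size p).+1 ->
    nth set0 (path_vertices (x :: p)) r = origin (nth x (x :: p) r).
  by case: r => // r rp; rewrite target_nth ?(ltnW rp) //; apply/eqP/adjp.
have back : nth x (x :: p) n.+1 = edge (nth x (x :: p) n).
  by rewrite ek e IHn develop_edge0 -addn1 PoszD.
have szv : size (path_vertices (x :: p)) = (size p).+2 by rewrite /= size_map.
have := nth_uniq set0 _ _ unip; rewrite szv => /(_ n n.+2 (ltnW (ltnW np)) np).
rewrite target_nth // origin_nth ?(ltnW np) //.
by rewrite back /target edgeK eqxx; lia.
Qed.

Lemma maximal_row p : maximal_class_path c (c x) (x :: p) -> x :: p = row x m.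
Proof.
case=> cp maxp; have ep := class_path_is_row cp.
have szp : (size p).+1 <= m.
  rewrite leqNgt; apply/negP => mp.
  have unip : uniq (path_vertices (x :: p)) by have /andP [/and3P []] := cp.
  rewrite ep path_vertices_row // in unip; have [m0 Lm] := xm.
  have /mkseq_uniqP/(_ m.-1 m.+1) := unip; rewrite !inE.
  case: m m0 mp Lm => // n _ np Lm h.
  (* The points m - 1 and m + 1 are opposite modulo 2m: past index m the row turns back on
     itself. *)
  suff /h : origin (develop x n 0 0) = origin (develop x n.+2 0 0).
    by move=> e; have : n = n.+2; [apply: e; lia | lia].
  rewrite -(origin_develop x n 0 3) (develop_opp x3 _ _ 0).
  have Ln : period x (n.+1%:Z + n.+1%:Z)%R 0 by have := Lm n.+1; rewrite dvdzz.
  rewrite -(develop_period _ _ 0 Ln); congr (origin (develop _ _ _ _)); lia.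
case: (ltngtP (size p).+1 m) szp => [pm _|//|pm _]; last by rewrite ep pm.
(* A shorter path is not maximal: the row prolongs it by one dart. *)
have cr : class_path c (c x) (row x (size p).+2) by apply: class_path_row.
have er : row x (size p).+2 = rcons (x :: p) (develop x (size p).+1 0 0).
  by rewrite ep /row mkseqS.
have := maxp _ cr; rewrite er infix_rcons => /(_ isT) /(congr1 size).
by rewrite size_rcons /=; lia.
Qed.

End Rows.

Lemma is_rayP A q p : is_ray c A q p -> exists x,
  [/\ A = origin x, (R ^+ 3)%g x = x, c x = q, row_period (half_period x) (size p)
    & p = row x (size p)].
Proof.
case=> _ dA mp; case: p mp => // x p mp [eA].
have cx : c x = q by have [/andP [_ /andP [/eqP]]] := mp.
have x3 : (R ^+ 3)%g x = x by apply: ccw3_degree3; rewrite eA.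
have [m xm] : exists m, row_period (half_period x) m.
  by apply: row_period_ex (period_straight x) => i j a b; apply: half_periodB.
rewrite -cx in mp; have e := maximal_row x3 xm mp.
by exists x; rewrite e size_row.
Qed.

(** The two base darts differ by a translation, and translations commute. *)
Lemma half_period_indep x y i j : (R ^+ 3)%g x = x -> (R ^+ 3)%g y = y -> c y = c x ->
  half_period y i j = half_period x i j.
Proof.
move=> x3 y3 cxy; have [a [b [-> _]]] := same_class_half_turn x3 y3 cxy.
exact: period_base.
Qed.

Section TwoRows.

Variables (x : P) (m k : nat).
Hypotheses (x3 : (R ^+ 3)%g x = x) (xm : row_period (half_period x) m).
Hypothesis xk : row_spacing (half_period x) k.
Local Notation D := (develop x).

Lemma period_even a b n : half_period x a b -> period x (n * (a + a))%R (n * (b + b))%R.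
Proof.
by move=> /(sublatticeZ (@half_periodB x) n); rewrite /half_period -!mulrDr.
Qed.

Lemma row_mod i : exists r : nat,
  [/\ r < m + m, forall t, D i 0 t = D r 0 t & (m%:Z %| (i - r%:Z)%R)%Z].
Proof.
have [m0 Lm] := xm; pose r := (i %% (m + m)%:Z)%Z; pose u := (i %/ (m + m)%:Z)%Z.
have er : i = (r + u * (m + m)%:Z)%R by rewrite addrC -divz_eq.
have r0 : (0 <= r)%R by rewrite modz_ge0; lia.
have rm : (r < (m + m)%:Z)%R by rewrite ltz_pmod //; lia.
have rabs : Posz `|r|%N = r by lia.
exists `|r|%N; split; first by lia.
  have pm : period x (u * (m%:Z + m%:Z))%R (u * (0 + 0))%R.
    by apply: period_even; rewrite Lm dvdzz.
  move=> t; rewrite rabs -(develop_period r 0%R t pm) addr0 mulr0 {1}er.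
  by congr develop; lia.
by rewrite rabs; apply/dvdzP; exists (u + u)%R; rewrite er; lia.
Qed.

Lemma mem_path_row (v : {set P}) : v \in path_vertices (row x m) ->
  exists2 i : nat, i <= m & v = origin (D i 0 0).
Proof.
have [m0 _] := xm; rewrite path_vertices_row // => /mapP [i].
by rewrite mem_iota add0n ltnS => /= im ->; exists i.
Qed.

Lemma origin_row (i : nat) : i <= m -> origin (D i 0 0) \in path_vertices (row x m).
Proof.
have [m0 _] := xm; rewrite path_vertices_row // => im.
by apply/mapP; exists i; rewrite // mem_iota.
Qed.

(** Periods have second coordinate divisible by 2k. Conversely, multiples of (2s, 2k) bring the
    point to row 0, then it is reduced modulo 2m, and a remainder r > m is replaced by 2m - r by a
    half-turn. *)
Lemma mem_row i j :
  (origin (D i j 0) \in path_vertices (row x m)) = ((k + k)%:Z %| j)%Z.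
Proof.
have [k0 [s Ls] dk] := xk; have [m0 Lm] := xm.
apply/idP/dvdzP => [/mem_path_row [t _ /(origin_develop_eq x3)]|[u ->]].
  by case=> /(even_period x3) [a [b [_ eb /dk /dvdzP [u ub]]]]; exists u; lia.
have -> : D i (u * (k + k)%:Z)%R 0 = D (i - u * (s + s))%R 0 0.
  rewrite -[RHS](develop_period _ _ 0 (period_even u Ls)).
  by congr develop; lia.
have [r [rm -> _]] := row_mod (i - u * (s + s))%R.
case: (leqP r m) => [|mr]; first exact: origin_row.
have pm : period x (1 * (m%:Z + m%:Z))%R (1 * (0 + 0))%R.
  by apply: period_even; rewrite Lm dvdzz.
rewrite -(origin_develop x _ _ 3) (develop_opp x3 _ _ 0) -(develop_period _ _ 0 pm).
rewrite (_ : D _ _ 0 = D (m + m - r)%N 0 0); last by congr develop; lia.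
by apply: origin_row; lia.
Qed.

(** At an inner vertex the darts of this class have directions 0 and 3, both along the row; at the
    two ends these directions give the same dart. *)
Lemma mem_path_darts_row z : (z \in path_darts (row x m)) =
  (origin z \in path_vertices (row x m)) && (c z == c x).
Proof.
have [m0 Lm] := xm.
have in_row (i : nat) : i < m -> D i 0 0 \in row x m.
  by move=> im; apply/mapP; exists i; rewrite // mem_iota.
have Dm : D m 0 3 = D m 0 0 by apply/half_periodP; rewrite ?Lm ?dvdzz.
have edge_row (i : nat) : edge (D i.+1 0 3) = D i 0 0.
  by rewrite -addn1 PoszD -develop_edge0 edgeK.
have [cE _] := hc.
rewrite inE; apply/idP/andP => [/orP [] /mapP [i]|[/mem_path_row [i im oz] /eqP cz]].
- rewrite mem_iota => /= im ->; rewrite class_develop addr0 eqxx; split=> //.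
  by apply: origin_row; lia.
- rewrite mem_iota => /= im /(congr1 edge); rewrite edgeK => ->.
  rewrite cE class_develop addr0 eqxx develop_edge0 origin_develop; split=> //.
  by rewrite addrC -intS; apply: origin_row.
have [e ez] := dart_of_origin oz.
have e0 : e = 0 %[mod 3].
  by apply: (@class_develop_eq x i 0 e 0%R 0%R 0); rewrite -ez cz -developE.
have [e1|e1] := develop_mod3 x i 0 e0; rewrite ez e1.
  case: (ltngtP i m) im => // [im _|-> _]; first by rewrite in_row.
  have := edge_row m.-1; rewrite prednK // => em.
  by rewrite -Dm em in_row ?orbT //; lia.
case: i im {oz ez e1} => [_|i im]; last by rewrite edge_row in_row // orbT.
by rewrite (develop_opp x3 _ _ 0) in_row.
Qed.

End TwoRows.

(** * The invariants M, K, S^+ and S^- *)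

Lemma row_spacing_half_period x : exists k, row_spacing (half_period x) k.
Proof.
have LB i j a b := @half_periodB x i j a b.
have [m xm] := row_period_ex LB (period_straight x).
exact: (row_spacing_ex LB xm (period_slant x)).
Qed.

(** The second end lies in [L], so k divides b; were b a multiple of 2k, [mem_row] would identify
    the two paths. Hence b is an odd multiple of k. *)
Lemma opposite_rows A C q p p' : opposite_rays c A C q p p' ->
  exists x a b k, [/\ (R ^+ 3)%g x = x, c x = q,
    row_period (half_period x) (size p) /\ row_spacing (half_period x) k,
    [/\ p = row x (size p), p' = row (develop x a b 0) (size p)
      & C = origin (develop x a b 0)]
    & half_period x a b /\ ((k + k)%:Z %| (b + k%:Z)%R)%Z].
Proof.
case=> /is_rayP [x [_ x3 cx xm ep]] /is_rayP [y [eC y3 cy ym ep']] pp'.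
have cxy : c y = c x by rewrite cx cy.
have [a [b [ey xab]]] := same_class_half_turn x3 y3 cxy.
have indep i j := half_period_indep i j x3 y3 cxy.
have em : size p' = size p.
  by apply: row_period_uniq xm; apply: row_period_eq ym => i j; rewrite indep.
rewrite em in ym ep'; move: (size p) ep ep' xm ym => n ep ep' xm ym {em}.
have [k xk] := row_spacing_half_period x.
have yk : row_spacing (half_period y) k by apply: row_spacing_eq xk.
exists x, a, b, k; split=> //; first by rewrite -ey eC; split.
split=> //; have [k0 _ /(_ a b xab) /dvdzP [u eb]] := xk.
have nb : ~~ ((k + k)%:Z %| b)%Z.
  apply: contra_neqN pp' => /dvdzP [v ev]; apply/setP=> z.
  rewrite ep ep' (mem_path_darts_row x3 xm) (mem_path_darts_row y3 ym) cxy.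
  congr andb; have [i [j [t ->]]] := develop_surj x z; rewrite origin_develop.
  rewrite (mem_row x3 xm xk).
  have -> : develop x i j 0 = develop y (i - a)%R (j - b)%R 0.
    by rewrite ey develop_base; congr develop; lia.
  rewrite (mem_row y3 ym yk); apply/dvdzP/dvdzP => -[w ew].
    by exists (w - v)%R; lia.
  by exists (w + v)%R; lia.
have [w [ew|ew]] : exists w : int, u = (w + w)%R \/ u = (w + w + 1)%R.
- by exists (u %/ 2)%Z; lia.
- by case/dvdzP: nb; exists w; rewrite eb ew; lia.
by apply/dvdzP; exists (w + 1)%R; rewrite eb ew; lia.
Qed.

Lemma is_KP q n : is_K c q n ->
  exists x, [/\ (R ^+ 3)%g x = x, c x = q & row_spacing (half_period x) n].
Proof.
case=> A [C [p [p' [/opposite_rows [x [a [b [k [x3 cx [xm xk] [ep ep' _]]]]]]]]]].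
move: ep ep' xm; set m := size p => -> -> xm.
move=> [xab /dvdzP [u eu]] [[v [t [vp pt tp' st]]] minn].
exists x; split=> //; suff <- : k = n by [].
set y := develop x a b 0 in tp' minn.
have y3 : (R ^+ 3)%g y = y by rewrite /y develop_ccwn; apply/half_periodP.
have indep i j : half_period y i j = half_period x i j by apply: period_base.
have ym : row_period (half_period y) m by apply: row_period_eq xm.
have yk : row_spacing (half_period y) k by apply: row_spacing_eq xk.
have mem_y i j : (origin (develop x i j 0) \in path_vertices (row y m)) =
    ((k + k)%:Z %| (j - b)%R)%Z.
  rewrite -(mem_row y3 ym yk (i - a)%R (j - b)%R) /y develop_base.
  by rewrite !(addrC _ (_ - _)%R) !subrK.
have [k0 _ _] := xk; apply/eqP; rewrite eqn_leq; apply/andP; split.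
  (* Lower bound: a lifted path leads from row 0 to an odd multiple of k. *)
  move: vp pt tp' => /(mem_path_row xm) [i _ ->] /adj_path_lift [i' [j' [-> jj]]].
  rewrite mem_y => /dvdzP [w ew]; rewrite -st.
  have ej : (j' = ((w + u) * 2 - 1) * k%:Z)%R by lia.
  by have [wu|wu] : (0 < w + u \/ w + u <= 0)%R; [lia | nia | nia].
(* Upper bound: k steps in direction e_1 from (0, 0). *)
pose t' := mkseq (fun j : nat => origin (develop x 0 j.+1 0)) k.
have st' : size t' = k by rewrite size_mkseq.
have lt' : last (origin (develop x 0 0 0)) t' = origin (develop x 0 k 0).
  by rewrite /t'; case: (k) k0 => // k' _; rewrite mkseqS last_rcons.
suff : n <= size t' by rewrite st'.
apply: (minn (origin (develop x 0 0 0))).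
- exact: (@origin_row x m xm 0).
- apply/(pathP set0) => j; rewrite st' => jk.
  have -> : nth set0 (origin (develop x 0 0 0) :: t') j = origin (develop x 0 j 0).
    by case: j jk => //= j jk; rewrite nth_mkseq // ltnW.
  rewrite nth_mkseq //; apply/existsP; exists (develop x 0 j 1).
  rewrite origin_develop eqxx /target develop_edge1 origin_develop.
  by rewrite -addn1 PoszD eqxx.
rewrite lt' mem_y; apply/dvdzP; exists (1 - u)%R; lia.
Qed.

(** * Left and right branches read off from directions *)

Section Branches.

Variables (x : P) (m : nat).
Hypotheses (x3 : (R ^+ 3)%g x = x) (xm : row_period (half_period x) m).
Local Notation D := (develop x).
Local Notation p := (row x m).

Lemma left_branch_row f (j e : nat) : j <= m -> branch_dart p f = D j 0 e ->
  branch_index p f = j /\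
  left_branch p f =
    (j < m) && (D j 0 1 == D j 0 e) || (0 < j) && (D j 0 e.+1 == D j 0 3).
Proof.
have [m0 _] := xm; move=> jm ef.
have ej : branch_index p f = j.
  rewrite /branch_index ef origin_develop path_vertices_row //.
  rewrite -(@nth_mkseq _ set0 (fun i : nat => origin (D i 0 0)) m.+1 j) //.
  by rewrite index_uniq ?size_mkseq // (uniq_path_row x3 xm).
split=> //; rewrite /left_branch ej ef size_row jm andbT develop_ccw.
congr orb; first by case: ltnP => // lt_j; rewrite nth_mkseq // develop_ccw.
case: j jm {ef ej} => // j jm /=.
by rewrite nth_mkseq // develop_edge0 -addn1 PoszD.
Qed.

Lemma half_period_row (j : nat) : D j 0 3 = D j 0 0 -> (m %| j)%N.
Proof. by case: xm => _ Lm /(half_periodP x3); rewrite Lm dvdzE. Qed.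

(** Directions 1 and 2 point left of the row. The ranges omit j = m for direction 1 and j = 0 for
    direction 2, where the end has degree 3 and the edge counts as a right branch. *)
Lemma branch_offset_left f (t j : nat) : t < 2 -> t <= j < m + t ->
  branch_dart p f = D j 0 t.+1 -> branch_offset p f = j.
Proof.
move=> t2 /andP [tj jm] ef; have jm' : j <= m by lia.
have [ej lf] := left_branch_row jm' ef.
suff lft : left_branch p f by rewrite /branch_offset /branch_value lft ej.
rewrite lf; case: t t2 {ef lf} tj jm => [|[|//]] _ tj jm.
  by rewrite addn0 in jm; rewrite jm eqxx.
by rewrite tj eqxx orbT.
Qed.

Lemma branch_offset_right f (t j : nat) : t < 2 -> 0 < j + t <= m ->
  branch_dart p f = D j 0 (t + 4) -> branch_offset p f = m - j.
Proof.
move=> t2 /andP [tj jm] ef; have jm' : j <= m by lia.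
have [ej lf] := left_branch_row jm' ef.
suff lft : left_branch p f = false.
  by rewrite /branch_offset /branch_value lft ej size_row; lia.
(* Inner vertices have degree 6. A right dart could match a left one only by a coincidence of
   opposite directions, or against its class. *)
have jm0 : 0 < j < m -> D j 0 3 <> D j 0 0.
  by case/andP=> j0 lt_j /half_period_row /(dvdn_leq j0); lia.
rewrite lf; apply/negP => /orP [] /andP [lt_j /eqP e].
  case: t t2 e {ef lf} tj jm => [|[|//]] _ e tj jm;
    last by have := class_develop_eq (congr1 c e).
  apply: jm0; first by lia.
  have := congr1 (R ^+ 2)%g e; rewrite !develop_ccwn -[D j 0 0]develop6; exact.
case: t t2 e {ef lf} tj jm => [|[|//]] _ e tj jm;
  first by have := class_develop_eq (congr1 c e).
by apply: jm0; [lia | rewrite -[D j 0 0]develop6; apply: esym].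
Qed.

End Branches.

(* The case t = 0 is that of S^+, and t = 1 is that of S^-. *)
Lemma is_SP t q n : t < 2 -> is_S c q (q + t.+1%:R)%R n -> exists x m k,
  [/\ (R ^+ 3)%g x = x, c x = q, row_period (half_period x) m,
      row_spacing (half_period x) k
    & half_period x (n%:Z - t%:Z * k%:Z)%R k /\ t <= n < m + t].
Proof.
move=> t2 [A [C [p [p' [r [f]]]]]].
case=> /opposite_rows [x [a [b [k [x3 cx [xm xk] [ep _ eC] [xab bk]]]]]].
move: ep xm; set m := size p => -> xm /is_rayP [z [eCz _ cz _ ->]] fadj <-.
exists x, m, k; split=> //.
have ez : z = develop x a b t.+1.
  have [e ez] := dart_of_origin (etrans (esym eCz) eC).
  have te : e = t.+1 %[mod 3].
    by apply: (@class_develop_eq x a b e a b); rewrite -ez cz class_develop cx.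
  have [e1|e1] := develop_mod3 x a b te; first by rewrite ez e1.
  have := congr1 (R ^+ t.+1)%g (proj1 (half_periodP x3 a b) xab).
  by rewrite !develop_ccwn add0n ez e1 addnC.
have ray_nth (l : nat) : develop z l 0 0 =
    develop x (a - t%:Z * l%:Z)%R (b + l%:Z)%R t.+1.
  rewrite ez; case: t t2 {ez cz fadj} => [|[|//]] _.
    by rewrite -(develop_ccw x a b 0) develop_rot develop_base; congr develop; lia.
  rewrite -(develop_ccw x a b 1) -(develop_ccw x a b 0) !develop_rot develop_base.
  by congr develop; lia.
have [k0 [s Ls] _] := xk; have [m0 Lm] := xm.
have adjE (l : nat) : adjacent (row x m) (develop z l 0 0) =
    ((k + k)%:Z %| (b + l%:Z)%R)%Z || ((k + k)%:Z %| (b + l.+1%:Z)%R)%Z.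
  rewrite /adjacent (mem_path_darts_row x3 xm) class_develop cz cx addr0.
  rewrite -subr_eq0 addrAC subrr add0r modn3_class [3 %| _]gtnNdvd // ?andbF.
  rewrite andTb ray_nth origin_develop (mem_row x3 xm xk); congr orb.
  case: t t2 {ez cz fadj ray_nth} => [|[|//]] _.
    rewrite /target develop_edge1 origin_develop (mem_row x3 xm xk).
    by congr (_ %| _)%Z; lia.
  rewrite /target develop_edge2 origin_develop (mem_row x3 xm xk).
  by congr (_ %| _)%Z; lia.
have [l [lr ef adjl minl]] := ohead_filterP z fadj.
rewrite size_row in lr; case/dvdzP: bk => u eu.
(* Dart l joins rows b + l and b + l + 1, and b + k = 2uk is the first multiple of 2k reached. *)
have lk : l.+1 = k.
  have lek : l < k.
    rewrite ltnNge; apply/negP => kl.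
    have k1l : k.-1 < l by lia.
    have := minl _ k1l; rewrite nth_mkseq ?adjE ?(ltn_trans k1l) //.
    case/norP=> _ /dvdzP [].
    by exists u; lia.
  move: adjl; rewrite ef nth_mkseq // adjE => /orP [] /dvdzP [v ev].
    have : ((v - u) * (k + k)%:Z = l%:Z - k%:Z)%R by lia.
    by move/small_multiple; lia.
  have : ((v - u) * (k + k)%:Z = l.+1%:Z - k%:Z)%R by lia.
  by move/small_multiple; lia.
(* The ray meets the first path at (a - t k, 2uk); the period u (2s, 2k) brings this to (I, 0), and
   the reversed dart has direction t + 4. *)
pose I := (a - t%:Z * k%:Z - u * (s + s))%R.
have branch_f : branch_dart (row x m) f = develop x I 0 (t + 4).
  rewrite /branch_dart ef nth_mkseq // ray_nth origin_develop (mem_row x3 xm xk).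
  case: ifPn => [/dvdzP [v ev]|_].
    have : ((u - v) * (k + k)%:Z = 1)%R by lia.
    by move/small_multiple; lia.
  rewrite -[RHS](develop_period _ _ _ (period_even u Ls)).
  case: t t2 {ez cz fadj adjE ray_nth} @I => [|[|//]] _ I.
    by rewrite develop_edge1 /I; congr develop; lia.
  by rewrite develop_edge2 /I; congr develop; lia.
have [r0 [r0m Ir0 /dvdzP [v ev]]] := row_mod xm I.
rewrite Ir0 in branch_f.
(* Since b = (2u - 1) k, also a = (2u - 1) s modulo m, so I = -s - t k modulo m and the offset is s
   + t k modulo m. *)
have [w ew] : exists w, (a - (u + u - 1) * s = w * m%:Z)%R.
  apply/dvdzP; rewrite -Lm.
  have := half_periodB xab (sublatticeZ (@half_periodB x) (u + u - 1)%R Ls).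
  by rewrite (_ : b - (u + u - 1) * k%:Z = 0)%R //; lia.
suff [y ey bnd] : exists2 y : int, ((branch_offset (row x m) f)%:Z = y * m%:Z - r0%:Z)%R
    & t <= branch_offset (row x m) f < m + t.
  split=> //; have mz : half_period x ((y + v - w) * m%:Z)%R 0 by rewrite Lm dvdz_mull.
  have := half_periodB Ls (sublatticeZ (@half_periodB x) (-1)%R mz).
  rewrite ey; congr half_period; rewrite /I in ev; lia.
(* The offset is 0 in the corner case r0 = t = 0, m - r0 on the right, and 2m - r0 on the left after
   a half-turn about (m, 0). *)
case: (posnP (r0 + t)) => [rt0|rt0].
  have [r00 t0] : r0 = 0 /\ t = 0 by lia.
  have e1 : branch_dart (row x m) f = develop x 0%N 0 1.
    by rewrite branch_f r00 t0 (develop_opp x3 0 0 1); congr develop; lia.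
  rewrite r00 t0; exists 0%R; rewrite (@branch_offset_left x m x3 xm _ 0 0) ?addn0 //.
case: (leqP (r0 + t) m) => rtm.
  by exists 1%R; rewrite (branch_offset_right x3 xm t2 _ branch_f) ?rt0 //; lia.
have e2 : branch_dart (row x m) f = develop x (m + m - r0)%N 0 t.+1.
  have pm : period x (1 * (m%:Z + m%:Z))%R (1 * (0 + 0))%R.
    by apply: period_even; rewrite Lm dvdzz.
  rewrite branch_f addnS (develop_opp x3 _ _ t.+1) -(develop_period _ _ _ pm).
  by congr develop; lia.
by exists 2%R; rewrite (branch_offset_left x3 xm t2 _ e2) //; lia.
Qed.

Lemma is_MP q n : is_M c q n ->
  exists x, [/\ (R ^+ 3)%g x = x, c x = q & row_period (half_period x) n].
Proof. by case=> A [p [/is_rayP [x [_ x3 cx xm _]] <-]]; exists x. Qed.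

Lemma class_invariants x m k sp sm : (R ^+ 3)%g x = x ->
  is_M c (c x) m -> is_K c (c x) k -> is_Splus c (c x) sp -> is_Sminus c (c x) sm ->
  [/\ row_period (half_period x) m, row_spacing (half_period x) k,
      half_period x sp k, 0 < sm <= m & half_period x (sm%:Z - k%:Z)%R k].
Proof.
move=> x3 hM hK hp hm.
have half y i j : (R ^+ 3)%g y = y -> c y = c x ->
    half_period x i j = half_period y i j.
  by move=> y3 cy; rewrite (half_period_indep i j x3 y3 cy).
have xm : row_period (half_period x) m.
  have [y [y3 cy]] := is_MP hM; apply: row_period_eq => i j; exact: half.
have xk : row_spacing (half_period x) k.
  have [y [y3 cy]] := is_KP hK; apply: row_spacing_eq => i j; exact: half.
have is_SP' t n : t < 2 -> is_S c (c x) (c x + t.+1%:R)%R n ->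
    half_period x (n%:Z - t%:Z * k%:Z)%R k /\ t <= n < m + t.
  move=> t2 /(is_SP t2) [y [m' [k' [y3 cy ym yk]]]].
  have -> : m' = m.
    by apply: row_period_uniq xm; apply: row_period_eq ym => i j; apply: half.
  have -> : k' = k.
    by apply: row_spacing_uniq xk; apply: row_spacing_eq yk => i j; apply: half.
  by rewrite (half _ _ _ y3 cy).
have [Lp _] := is_SP' 0 sp isT hp.
(* In 'Z_3, subtracting 1 is adding 2, which is the case t = 1. *)
have [|Lm sm_bnd] := is_SP' 1 sm isT.
  move: hm; rewrite /is_Sminus; congr is_S; congr (_ + _)%R; exact: val_inj.
split=> //; first by rewrite mul0r subr0 in Lp.
  by rewrite addn1 ltnS in sm_bnd.
by rewrite mul1r in Lm.
Qed.

End Development.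

Theorem theorem3p2 (P : gmap) (c : P -> 'Z_3)
    (M K Splus Sminus : 'Z_3 -> nat) (q : 'Z_3) (d a b : nat)
    (hP : family_P P) (hc : class_partition c)
    (hM : forall r : 'Z_3, is_M c r (M r))
    (hK : forall r : 'Z_3, is_K c r (K r))
    (hSplus : forall r : 'Z_3, is_Splus c r (Splus r))
    (hSminus : forall r : 'Z_3, is_Sminus c r (Sminus r))
    (hd : d = gcdn (Splus q) (M q))
    (ha : 0 < a) (hb : 0 < b)
    (hab : ((a * M q)%:Z - (b * Splus q)%:Z = d%:Z)%R)
    (hbd : b <= M q %/ d) :
  Sminus (q + 1)%R = b * K q /\
  (Posz (Splus (q + 1)%R) = (b * K q)%:Z - (K (q + 1)%R)%:Z
     %[mod M (q + 1)%R])%Z.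
Proof.
have [x [x3 cx _]] := is_MP hP hc (hM q).
(* The next dart at the same vertex serves as base for class q + 1; [half_period_ccw] relates the
   two lattices. *)
have y3 : (ccw ^+ 3)%g (ccw x) = ccw x by rewrite -permM -expgS expgSr permM x3.
have cy : c (ccw x) = (q + 1)%R by rewrite hc.2 cx.
have := class_invariants hP hc x3 (hM _) (hK _) (hSplus _) (hSminus _).
have := class_invariants hP hc y3 (hM _) (hK _) (hSplus _) (hSminus _).
rewrite cx cy => -[ym yk yp y_bnd yn] [xm xk xp _ _].
exact: (change_of_basis (@half_periodB _ hP x) (@half_period_ccw _ hP x)
  xm xk xp ym yk yp y_bnd yn hd hb hab hbd).
Qed.
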